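(* Let $\mathcal{B}$ be a Muckenhoupt basis in $\mathbb{R}^n$, let $1<p_0<\infty$ and $\beta\in\mathbb{R}$, and suppose that there is a constant $c$, independent of $w$, such that the associated maximal operator $M_{\mathcal{B}}$ satisfies $$\|M_{\mathcal{B}}\|_{L^{p_0}(w)}\le c\,[w]_{A_{p_0,\mathcal{B}}}^{\beta}\qquad\text{for every } w\in A_{p_0,\mathcal{B}}.$$ If $\limsup_{p\to1^+}\|M_{\mathcal{B}}\|_{L^p(\mathbb{R}^n)}=+\infty$, then $\beta\ge\frac1{p_0-1}$.
   Context: Given a family $\mathcal{B}$ of open sets in $\mathbb{R}^n$, the associated maximal operator is $$M_{\mathcal{B}}f(x)=\sup_{x\in B\in\mathcal{B}}\frac1{|B|}\int_B|f(y)|\,dy$$ if $x$ belongs to some $B\in\mathcal{B}$, and $M_{\mathcal{B}}f(x)=0$ otherwise. A weight is a non-negative locally integrable function $w$. For $1<p<\infty$, with $1/p+1/p'=1$, $w\in A_{p,\mathcal{B}}$ means $$[w]_{A_{p,\mathcal{B}}}:=\sup_{B\in\mathcal{B}}\left(\frac1{|B|}\int_B w\right)\left(\frac1{|B|}\int_B w^{1-p'}\right)^{p-1}<\infty.$$ $\mathcal{B}$ is a Muckenhoupt basis if, for every $1<p<\infty$, $M_{\mathcal{B}}$ is bounded on $L^p(w)$ whenever $w\in A_{p,\mathcal{B}}$. $\|f\|_{L^p(w)}=(\int|f|^p w\,dx)^{1/p}$, and $\|T\|_{L^p(w)}$ denotes the smallest constant $C$ such that $\|Tf\|_{L^p(w)}\le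 C\|f\|_{L^p(w)}$ for all $f\in L^p(w)$; $\|T\|_{L^p(\mathbb{R}^n)}$ is the case $w\equiv1$. *)

(* Defs.v *)
From HB Require Import structures.
From mathcomp Require Import all_boot all_order all_algebra.
From mathcomp Require Import all_classical all_reals all_analysis.
From mathcomp Require Import measurable_realfun lra.
Set Implicit Arguments.
Unset Strict Implicit.
Unset Printing Implicit Defensive.
Import Order.TTheory GRing.Theory Num.Theory.
Import numFieldNormedType.Exports.

Local Open Scope classical_set_scope.
Local Open Scope ring_scope.

(* R^n is 'rV[R]_n with the topology of the library and its Borel
   sigma-algebra. *)
Section rV_borel.
Context (R : realType) (n : nat).

HB.instance Definition _ := @isMeasurable.Build default_measure_display
  'rV[R]_n <<s @open 'rV[R]_n >> (@sigma_algebra0 _ _ _) (@sigma_algebraC _ _)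
  (@sigma_algebra_bigcup _ _ _).

Lemma rV_open_measurable (A : set 'rV[R]_n) : open A -> measurable A.
Proof. exact: sub_sigma_algebra. Qed.

Lemma rV_measurable_coord (i : 'I_n) :
  measurable_fun [set: 'rV[R]_n] (fun v : 'rV[R]_n => v 0 i).
Proof.
apply: (measurability _ (@RGenOpens.measurableE R)) => _ [_ [a [b ->]] <-].
rewrite setTI; apply: rV_open_measurable; apply: open_comp; last exact: itv_open.
by move=> x _; exact: coord_continuous.
Qed.

Let rat_box (ab : 'rV[rat]_n * 'rV[rat]_n) : set 'rV[R]_n :=
  [set v | forall i, ratr (ab.1 0 i) < v 0 i < ratr (ab.2 0 i)].

Let open_rat_box (A : set 'rV[R]_n) : open A ->
  A = \bigcup_(ab in [set ab | rat_box ab `<=` A]) rat_box ab.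
Proof.
move=> oA; apply/seteqP; split=> [v Av|v [ab /= + abv]]; last exact.
have [P Pv PA] : nbhs v A by exact: open_nbhs_nbhs.
have /choice[q qP] : forall i, exists q : rat * rat,
    (ratr q.1 < v 0 i < ratr q.2) /\
    (forall y : R, ratr q.1 < y < ratr q.2 -> P 0 i y).
  move=> i; have /nbhs_ballP[e /= e0 vP] := Pv 0 i.
  have /rat_in_itvoo[a] : v 0 i - e < v 0 i by rewrite ltrBlDr ltrDl.
  have /rat_in_itvoo[b] : v 0 i < v 0 i + e by rewrite ltrDl.
  rewrite !in_itv/= => /andP[vb be] /andP[ae av].
  exists (a, b); split => /=; first by rewrite av.
  move=> y /andP[ay yb]; apply: vP; rewrite /ball/= ltr_norml.
  by apply/andP; split; lra.
exists (\row_i (q i).1, \row_i (q i).2) => /=.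
  move=> u /= uq; apply: PA => i j; rewrite ord1; have [_] := qP j; apply.
  by have := uq j; rewrite !mxE.
by move=> i; rewrite !mxE; have [] := qP i.
Qed.

Lemma rV_measurable_box (a b : 'rV[R]_n) :
  measurable [set v : 'rV[R]_n | forall i, a 0 i < v 0 i < b 0 i].
Proof.
have -> : [set v : 'rV[R]_n | forall i, a 0 i < v 0 i < b 0 i] =
    \bigcap_(i in [set: 'I_n])
      ((fun v : 'rV[R]_n => v 0 i) @^-1` `]a 0 i, b 0 i[).
  apply/seteqP; split=> [v vab i _ /=|v vab i]; first by rewrite in_itv/=.
  by have := vab i I; rewrite /= in_itv.
apply: fin_bigcap_measurable => // i _.
by rewrite -[X in measurable X]setTI; exact: rV_measurable_coord.
Qed.

Lemma rV_measurable_funP d (T : measurableType d) (f : T -> 'rV[R]_n) :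
  (forall i, measurable_fun [set: T] (fun x => f x 0 i)) ->
  measurable_fun [set: T] f.
Proof.
move=> mf; apply: (measurability (@open 'rV[R]_n)) => // _ [A oA <-].
rewrite setTI (open_rat_box oA) preimage_bigcup bigcup_mkcond.
apply: countable_bigcupT_measurable => // ab; case: ifP => // _.
have -> : f @^-1` rat_box ab = \bigcap_(i in [set: 'I_n])
    ((fun x => f x 0 i) @^-1` `]ratr (ab.1 0 i), ratr (ab.2 0 i)[).
  apply/seteqP; split=> [x /= xab i _ /=|x xab i]; first by rewrite in_itv/=.
  by have := xab i I; rewrite /= in_itv.
apply: fin_bigcap_measurable => // i _.
by rewrite -[X in measurable X]setTI; exact: mf.
Qed.

End rV_borel.

(* Lebesgue measure on R^n.+1 is the product of the Lebesgue measures on R and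
   R^n, transported along the following map. *)
Definition rV_cons (R : realType) n (x : R * 'rV[R]_n) : 'rV[R]_n.+1 :=
  row_mx (x.1%:M : 'rV_1) x.2.

Section rV_cons.
Context (R : realType) (n : nat).

Lemma measurable_rV_cons : measurable_fun [set: R * 'rV[R]_n] (@rV_cons R n).
Proof.
apply: rV_measurable_funP => i; rewrite /rV_cons.
have [j ->|j ->] := @split_ordP 1 n i.
  rewrite [X in measurable_fun _ X](_ : _ = fst) //; apply/funext => x.
  by rewrite [LHS]row_mxEl ord1 mxE eqxx mulr1n.
rewrite [X in measurable_fun _ X](_ : _ = (fun v : 'rV_n => v 0 j) \o snd).
  by apply: measurableT_comp; [exact: rV_measurable_coord|exact: measurable_snd].
by apply/funext => x; rewrite [LHS]row_mxEr.
Qed.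

Let measurable_behead : measurable_fun [set: 'rV[R]_n.+1]
  (rsubmx : 'rV[R]_(1 + n) -> 'rV[R]_n).
Proof.
apply: rV_measurable_funP => i; under eq_fun do rewrite mxE.
exact: rV_measurable_coord.
Qed.

Context (mu : {sigma_finite_measure set 'rV[R]_n -> \bar R}).

Definition lebesgue_rV_cons : set 'rV[R]_n.+1 -> \bar R :=
  pushforward (lebesgue_measure \x mu)%E (@rV_cons R n).

HB.instance Definition _ := Measure.copy lebesgue_rV_cons
  (measure_function_pushforward__canonical__measure_function_Measure (lebesgue_measure \x mu)%E measurable_rV_cons).

Let rV_cons_preimage (A : set R) (B : set 'rV[R]_n) : @rV_cons R n @^-1`
  [set v : 'rV[R]_n.+1 | A (v 0 0) /\ B (@rsubmx R 1 1 n v)] = A `*` B.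
Proof.
have E0 (x : R * 'rV[R]_n) : rV_cons x 0 0 = x.1.
  transitivity (row_mx (x.1%:M : 'rV_1) x.2 0 (lshift n (0 : 'I_1))).
    by congr (row_mx _ _ _ _); exact/val_inj.
  by rewrite row_mxEl mxE eqxx mulr1n.
have ES (x : R * 'rV[R]_n) : @rsubmx R 1 1 n (rV_cons x) = x.2 by exact: row_mxKr.
by apply/seteqP; split=> x /=; rewrite E0 ES.
Qed.

Let measurable_cylinder (A : set R) (B : set 'rV[R]_n) :
  measurable A -> measurable B ->
  measurable [set v : 'rV[R]_n.+1 | A (v 0 0) /\ B (@rsubmx R 1 1 n v)].
Proof.
move=> mA mB; apply: measurableI.
  by rewrite -[X in measurable X]setTI; exact: rV_measurable_coord.
by rewrite -[X in measurable X]setTI; exact: measurable_behead.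
Qed.

Lemma lebesgue_rV_consE (A : set R) (B : set 'rV[R]_n) :
  measurable A -> measurable B ->
  lebesgue_rV_cons
    [set v : 'rV[R]_n.+1 | A (v 0 0) /\ B (@rsubmx R 1 1 n v)] =
  (lebesgue_measure A * mu B)%E.
Proof.
move=> mA mB.
by rewrite /lebesgue_rV_cons /pushforward rV_cons_preimage product_measure1E.
Qed.

Let sigma_finite_lebesgue_rV_cons : sigma_finite setT lebesgue_rV_cons.
Proof.
have /sigma_finiteP[F [TF ndF Foo]] := sigma_finiteT (@lebesgue_measure R).
have /sigma_finiteP[G [TG ndG Goo]] := sigma_finiteT mu.
exists (fun k =>
    [set v : 'rV[R]_n.+1 | F k (v 0 0) /\ G k (@rsubmx R 1 1 n v)]).
  rewrite predeqE => v; split => // _.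
  have [k _ Fk] : (\bigcup_i F i) (v 0 0) by rewrite -TF.
  have [l _ Gl] : (\bigcup_i G i) (@rsubmx R 1 1 n v) by rewrite -TG.
  exists (maxn k l) => //; split.
    by move: Fk; exact/subsetPset/ndF/leq_maxl.
  by move: Gl; exact/subsetPset/ndG/leq_maxr.
move=> k; have [mF Fky] := Foo k; have [mG Gky] := Goo k.
split; first exact: measurable_cylinder.
by rewrite lebesgue_rV_consE// lte_mul_pinfty// ge0_fin_numE.
Qed.

HB.instance Definition _ := Measure_isSigmaFinite.Build _ _ _ lebesgue_rV_cons
  sigma_finite_lebesgue_rV_cons.

End rV_cons.

Fixpoint lebesgue_rV (R : realType) (n : nat) :
    {sigma_finite_measure set 'rV[R]_n -> \bar R} :=
  if n is m.+1 then lebesgue_rV_cons (lebesgue_rV R m) else \d_(0 : 'rV[R]_0).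

Lemma lebesgue_rV_box (R : realType) n (a b : 'rV[R]_n) :
  (forall i, a 0 i <= b 0 i) ->
  lebesgue_rV R n [set v | forall i, a 0 i < v 0 i < b 0 i] =
  (\prod_(i < n) (b 0 i - a 0 i))%:E.
Proof.
elim: n a b => [a b _|n IHn a b ab].
  rewrite big_ord0 /= diracE mem_set//=.
  by case.
rewrite big_ord_recl EFinM.
set box := (X in lebesgue_rV _ _ X).
have -> : box = [set v : 'rV[R]_n.+1 | `]a 0 0, b 0 0[%classic (v 0 0) /\
    [set v | forall i, @rsubmx R 1 1 n a 0 i < v 0 i < @rsubmx R 1 1 n b 0 i]
    (@rsubmx R 1 1 n v)].
  apply/seteqP; split=> v.
    move=> vab; split; first by rewrite /= in_itv; exact: vab.
    by move=> i; rewrite !mxE; exact: vab.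
  rewrite /= in_itv/= => -[va vb] i; have [j ->|j ->] := @split_ordP 1 n i.
    have -> // : lshift n j = 0 by apply/val_inj; rewrite ord1.
  by have := vb j; rewrite !mxE.
apply: etrans.
  exact: (@lebesgue_rV_consE R n (lebesgue_rV R n) `]a 0 0, b 0 0[%classic
    [set v | forall i, @rsubmx R 1 1 n a 0 i < v 0 i < @rsubmx R 1 1 n b 0 i]
    (measurable_itv _) (@rV_measurable_box _ _ _ _)).
rewrite IHn => [|i]; last by rewrite !mxE.
rewrite lebesgue_measure_itv/= lte_fin -EFinB; congr (_ * _)%E; last first.
  congr EFin; apply: eq_bigr => i _; rewrite !mxE.
  by congr (b 0 _ - a 0 _); exact/val_inj.
case: ltP => // ba; congr EFin; apply/esym/eqP; rewrite subr_eq0.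
by rewrite eq_le ba ab.
Qed.

Section maximal.
Context (R : realType) (n : nat).
Local Open Scope ereal_scope.

Local Notation mu := (lebesgue_rV R n).
Implicit Types (BB : set (set 'rV[R]_n)) (B : set 'rV[R]_n) (w : 'rV[R]_n -> R).

(* The inverse and the product of extended reals satisfy +oo^-1 = 0,
   0^-1 = +oo and 0 * +oo = 0, so this is 0 if mu B is 0 or +oo: such a B
   contributes neither to the maximal operator nor to the A_p constant. *)
Definition average B (f : 'rV[R]_n -> \bar R) : \bar R :=
  (\int[mu]_(y in B) f y) / mu B.

Definition maximal BB (f : 'rV[R]_n -> R) (x : 'rV[R]_n) : \bar R :=
  if `[< exists2 B, BB B & B x >] then
    ereal_sup [set average B (fun y => `|(f y)%:E|)
              | B in [set B | BB B /\ B x]]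
  else 0.

Definition weight w : Prop :=
  [/\ measurable_fun setT w, (forall x, (0 <= w x)%R) &
      forall K, compact K -> \int[mu]_(x in K) (w x)%:E < +oo].

Definition conjugate_exponent (p : R) : R := (p / (p - 1))%R.

(* The real power function has 0 `^ r = 0 for every r != 0; a negative power
   of a weight must be +oo where the weight vanishes. *)
Definition epow (a r : R) : \bar R :=
  if (a == 0%R) && (r < 0)%R then +oo else (a `^ r)%:E.

Definition Ap_constant BB (p : R) w : \bar R :=
  ereal_sup [set average B (EFin \o w) *
    average B (fun x => epow (w x) (1 - conjugate_exponent p)) `^ (p - 1)
    | B in BB].

Definition Ap BB (p : R) w : Prop := weight w /\ Ap_constant BB p w < +oo.

Definition wnorm (p : R) w (g : 'rV[R]_n -> \bar R) : \bar R :=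
  (\int[mu]_x (`|g x| `^ p * (w x)%:E)) `^ p^-1.

Definition wLp (p : R) w (f : 'rV[R]_n -> R) : Prop :=
  measurable_fun setT f /\ wnorm p w (EFin \o f) < +oo.

Definition operator_bound (T : ('rV[R]_n -> R) -> 'rV[R]_n -> \bar R)
    (p : R) w (C : R) : Prop :=
  (0 <= C)%R /\
  forall f, wLp p w f -> wnorm p w (T f) <= C%:E * wnorm p w (EFin \o f).

(* +oo if T is not bounded on L^p(w) *)
Definition operator_norm (T : ('rV[R]_n -> R) -> 'rV[R]_n -> \bar R)
    (p : R) w : \bar R :=
  ereal_inf [set C%:E | C in operator_bound T p w].

Definition Muckenhoupt_basis BB : Prop :=
  (forall B, BB B -> open B) /\
  forall p w, (1 < p)%R -> Ap BB p w ->
    exists C, operator_bound (maximal BB) p w C.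

End maximal.

(* Main.v *)
(* Suppose M is bounded by N on L^p, 1 < p < q = p0, and let f be in L^p.  The
   Rubio de Francia function S = sum_k (4N)^-k M^k |f| dominates |f|, has L^p
   norm at most a constant times that of f, and satisfies avg_B S <= 4N S a.e.
   on every B.  Hence g = max(S, d), d > 0, satisfies the A_1 condition with
   constant 4N + 1, and w = g^(p-q) is locally integrable (it is bounded) with
   [w]_{A_q} <= 2^(q-1) (4N + 1)^(q-p).  Since |f|^q w <= |f|^p, a bound A for
   M on L^q(w) controls the integral of (Mf)^q w by A^q |f|_p^p, and splitting
   according to whether Mf <= A g gives a bound O(A) for M on L^p, after letting
   d tend to 0.  If beta < 1/(q-1), the hypothesis provides A = O(N^t + 1) with
   t = max(0, (q-1) beta) < 1, uniformly in p, so the norms of M on L^p stay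
   bounded as p -> 1. *)
Require Import Defs.
From mathcomp Require Import all_boot all_order all_algebra.
From mathcomp Require Import all_classical all_reals all_analysis.
From mathcomp Require Import measurable_realfun lra ring.
Set Implicit Arguments.
Unset Strict Implicit.
Unset Printing Implicit Defensive.
Import Order.TTheory GRing.Theory Num.Theory.
Import numFieldNormedType.Exports.
Local Open Scope classical_set_scope.
Local Open Scope ring_scope.

(** * Elementary inequalities between real powers *)

Section powers.
Context (R : realType).
Implicit Types a g t r p q : R.

(* Splitting according to whether [a <= A * g]; takes the place of Hoelder's
   inequality. *)
Lemma powR_split_le (a : \bar R) g A p q : (0 <= a)%E -> 0 < g -> 0 < A ->
  0 < p -> p < q ->
  (a `^ p <= ((A * g) `^ p)%:E +
             (A `^ (p - q))%:E * (a `^ q * (g `^ (p - q))%:E))%E.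
Proof.
move=> a0 g0 A0 p0 pq; have q0 := lt_trans p0 pq.
case: a a0 => [a|_|//]; last first.
  rewrite poweRyr ?gt_eqF// poweRyr ?gt_eqF//.
  by rewrite gt0_mulye ?lte_fin ?powR_gt0// gt0_muley ?lte_fin ?powR_gt0// addey.
rewrite lee_fin => a0; rewrite !poweR_EFin -!EFinM -EFinD lee_fin.
have Ag0 : 0 < A * g by rewrite mulr_gt0.
have [aAg|Aga] := leP a (A * g).
  rewrite ler_wpDr ?mulr_ge0 ?powR_ge0//.
  by rewrite ge0_ler_powR// ?nnegrE// ltW.
have a'0 := lt_trans Ag0 Aga.
rewrite ler_wpDl ?powR_ge0// mulrCA -powRM ?(ltW A0) ?(ltW g0)//.
have -> : a `^ p = a `^ q * a `^ (p - q).
  by rewrite -powRD ?subrKC// (gt_eqF a'0) implybT.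
rewrite ler_pM2l ?powR_gt0// -(opprB q p) !powRN lef_pV2 ?posrE ?powR_gt0//.
by rewrite ge0_ler_powR// ?nnegrE ?subr_ge0 ltW.
Qed.

(** From a <= g follows a^(q-p) <= g^(q-p). With [g] a majorant of |f| and the weight g^(p-q), this
    places an L^p function in the weighted L^q. *)
Lemma powR_shift_le a g p q : 0 <= a -> a <= g -> 0 < g -> 0 < p -> p < q ->
  a `^ q * g `^ (p - q) <= a `^ p.
Proof.
move=> a0 ag g0 p0 pq; have q0 := lt_trans p0 pq.
rewrite -(opprB q p) powRN ler_pdivrMr ?powR_gt0//.
have [->|an0] := eqVneq a 0; first by rewrite !powR0 ?gt_eqF// mul0r.
have -> : a `^ q = a `^ p * a `^ (q - p).
  by rewrite -powRD ?subrKC// an0 implybT.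
rewrite ler_wpM2l ?powR_ge0//.
by rewrite ge0_ler_powR// ?nnegrE ?subr_ge0 ltW.
Qed.

(* Takes the place of Jensen's inequality, at the cost of a factor 2. *)
Lemma powR_le_linear g t r : 0 < g -> 0 < t -> 0 <= r <= 1 ->
  g `^ r <= t `^ r + t `^ r / t * g.
Proof.
move=> g0 t0 /andP[r0 r1].
have gt0 : 0 < g / t by rewrite divr_gt0.
have -> : t `^ r + t `^ r / t * g = t `^ r * (1 + g / t) by field; rewrite gt_eqF.
have -> : g `^ r = t `^ r * (g / t) `^ r.
  by rewrite -powRM ?(ltW t0) ?(ltW gt0)// mulrC divfK ?gt_eqF.
rewrite ler_wpM2l ?powR_ge0//; have [gt1|gt1] := leP (g / t) 1.
  apply: (@le_trans _ _ 1); last by rewrite lerDl ltW.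
  by have := ge0_ler_powR r0 (ltW gt0) ler01 gt1; rewrite powR1.
rewrite ler_wpDl//; have := ler_powR (ltW gt1) r1.
by rewrite powRr1 // ltW.
Qed.

(** Since X^t >= 1, the constant [b] is absorbed into the coefficient of X^t; division by X^t leaves
    X^(1-t) <= a + b. This turns a bound of a norm by a sublinear function of itself into an
    absolute one. *)
Lemma sublinear_bound X a b t : 1 <= X -> 0 <= a -> 0 <= b -> 0 <= t < 1 ->
  X <= a * X `^ t + b -> X <= (a + b) `^ (1 - t)^-1.
Proof.
move=> X1 a0 b0 /andP[t0 t1] Xab; have X0 : 0 < X by lra.
have Xt1 : 1 <= X `^ t.
  by have := ge0_ler_powR t0 ler01 (ltW X0) X1; rewrite powR1.
have {}Xab : X <= (a + b) * X `^ t.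
  by rewrite mulrDl (le_trans Xab)// lerD2l ler_peMr.
have u0 : 0 < 1 - t by lra.
have -> : X = (X `^ (1 - t)) `^ (1 - t)^-1.
  by rewrite -powRrM mulfV ?gt_eqF// powRr1// ltW.
apply: ge0_ler_powR; rewrite ?nnegrE ?powR_ge0 ?addr_ge0 ?invr_ge0 ?(ltW u0)//.
rewrite powRD ?(gt_eqF X0) ?implybT// powRr1 ?(ltW X0)// powRN.
by rewrite ler_pdivrMr// powR_gt0.
Qed.

End powers.

(** * Averages over a set and their degenerate cases *)

Section averages.
Context (R : realType) (n : nat).
Local Open Scope ereal_scope.
Local Notation mu := (lebesgue_rV R n).
Implicit Types (B : set 'rV[R]_n) (f g : 'rV[R]_n -> \bar R).

(** A bounded set lies in an open box, whose measure is a finite product of side lengths. Bounded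
    measurable functions are therefore integrable over [K], as [weight] demands. *)
Lemma lebesgue_rV_compact (K : set 'rV[R]_n) :
  compact K -> measurable K /\ mu K < +oo.
Proof.
move=> cK; have mK : measurable K.
  rewrite -(setCK K); apply: measurableC; apply: rV_open_measurable.
  apply: closed_openC.
  exact: (@compact_closed _ K (@norm_hausdorff R 'rV[R]_n) cK).
split=> //; have [M [Mreal /(_ (M + 1)%R)]] := compact_bounded cK.
rewrite ltrDl ltr01 => /(_ erefl) KM.
set b := (`|M + 2|)%R; have b0 : (0 <= b)%R by rewrite /b.
pose D := [set v : 'rV[R]_n | forall i,
  (const_mx (- b) : 'rV[R]_n) 0 i < v 0 i < (const_mx b : 'rV[R]_n) 0 i]%R.
apply: (@le_lt_trans _ _ (mu D)); last first.
  by rewrite /D lebesgue_rV_box ?ltry// => i; rewrite !mxE; lra.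
rewrite le_measure// ?inE//; first exact: rV_measurable_box.
move=> v Kv /= i; rewrite !mxE -ltr_norml.
have := KM v Kv; rewrite /= -[`|v|%R]/(mx_norm v) mx_normrE => vM.
have := le_trans (le_bigmax _ (fun ij : 'I_1 * 'I_n => `|v ij.1 ij.2|%R) (ord0, i)) vM.
by move=> /= /le_lt_trans; apply; rewrite /b; apply: (@lt_le_trans _ _ (M + 2)%R); [lra|exact: ler_norm].
Qed.

Lemma average_ge0 B f : (forall x, B x -> 0 <= f x) -> 0 <= average B f.
Proof. by move=> f0; rewrite mule_ge0 ?inve_ge0 ?integral_ge0. Qed.

(** For measure 0 the integral vanishes and 0 times +oo is 0; for measure +oo the inverse is 0. Such
    sets drop out of every later estimate. *)
Lemma average_null B f : measurable B -> measurable_fun B f ->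
  mu B = 0 \/ mu B = +oo -> average B f = 0.
Proof.
move=> mB mf; rewrite /average => -[B0|->]; last by rewrite invey mule0.
by rewrite null_set_integral// mul0e.
Qed.

Lemma ae_le_average B f g : measurable B ->
  measurable_fun B f -> measurable_fun B g ->
  (forall x, B x -> 0 <= f x) -> (forall x, B x -> 0 <= g x) ->
  {ae mu, forall x, B x -> f x <= g x} -> average B f <= average B g.
Proof.
move=> mB mf mg f0 g0 fg; rewrite lee_wpmul2r ?inve_ge0//.
exact: ae_ge0_le_integral.
Qed.

Lemma averageD B f g : measurable B ->
  measurable_fun B f -> measurable_fun B g ->
  (forall x, B x -> 0 <= f x) -> (forall x, B x -> 0 <= g x) ->
  average B (fun x => f x + g x) = average B f + average B g.
Proof.
move=> mB mf mg f0 g0; rewrite /average ge0_integralD// ge0_muleDl//.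
  exact: integral_ge0.
exact: integral_ge0.
Qed.

Lemma averageZl B f k : measurable B -> measurable_fun B f ->
  (forall x, B x -> 0 <= f x) -> 0 <= k ->
  average B (fun x => k * f x) = k * average B f.
Proof. by move=> mB mf f0 k0; rewrite /average ge0_integralZl// muleA. Qed.

Lemma average_cst B (c : \bar R) : measurable B -> 0 < mu B < +oo ->
  average B (cst c) = c.
Proof.
move=> mB /andP[B0 Boo]; rewrite /average integral_cst// -muleA divee ?mule1//.
  by rewrite ge0_fin_numE.
by rewrite gt_eqF.
Qed.

Lemma average_cst_le B (c : \bar R) : measurable B -> 0 <= c ->
  average B (cst c) <= c.
Proof.
move=> mB c0; have [B0|B0] := eqVneq (mu B) 0.
  by rewrite average_null//; left.
have [Boo|Boo] := eqVneq (mu B) +oo.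
  by rewrite average_null//; right.
by rewrite average_cst// lt0e B0 measure_ge0 ltey Boo.
Qed.

Lemma average_nneseries B (f : nat -> 'rV[R]_n -> \bar R) : measurable B ->
  (forall k, measurable_fun B (f k)) -> (forall k x, B x -> 0 <= f k x) ->
  average B (fun x => \sum_(k <oo) f k x) = \sum_(k <oo) average B (f k).
Proof.
move=> mB mf f0; rewrite /average integral_nneseries//.
have I0 k : 0 <= \int[mu]_(x in B) f k x by apply: integral_ge0 => x; exact: f0.
(* A null [B] is treated apart, since its inverse measure is +oo and the series is scaled below by a
   finite factor. *)
have [B0|B0] := eqVneq (mu B) 0.
  rewrite eseries0 ?mul0e ?eseries0// => k _ _.
  by rewrite null_set_integral// mul0e.
  by rewrite null_set_integral.
have := fin_numV B0; have : mu B != -oo by rewrite -ltNye (lt_le_trans _ (measure_ge0 _ _)).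
move=> /[swap]/[apply] /fineK <-.
by rewrite muleC -nneseriesZl//; apply: eq_eseriesr => k _; rewrite muleC.
Qed.

End averages.

(** * Measurability and pointwise bounds of the maximal operator *)

Section maximal_operator.
Context (R : realType) (n : nat) (BB : set (set 'rV[R]_n)).
Hypothesis openBB : forall B, BB B -> open B.
Local Open Scope ereal_scope.
Local Notation mu := (lebesgue_rV R n).
Implicit Types (B : set 'rV[R]_n) (f g : 'rV[R]_n -> R).

Lemma average_le_maximal B f x : BB B -> B x ->
  average B (fun y => `|(f y)%:E|) <= maximal BB f x.
Proof.
move=> BBB Bx; rewrite /maximal asboolT; last by exists B.
by apply: ereal_sup_ubound; exists B.
Qed.

Lemma maximal_le f x c : 0 <= c -> (forall B, BB B -> B x ->
  average B (fun y => `|(f y)%:E|) <= c) -> maximal BB f x <= c.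
Proof.
move=> c0 fc; rewrite /maximal; case: ifPn => // _.
by apply: ge_ereal_sup => _ [B [BBB Bx] <-]; exact: fc.
Qed.

Lemma maximal_ge0 f x : 0 <= maximal BB f x.
Proof.
rewrite /maximal; case: ifPn => // /asboolP[B BBB Bx].
apply: (@le_trans _ _ (average B (fun y => `|(f y)%:E|))).
  exact: average_ge0.
by apply: ereal_sup_ubound; exists B.
Qed.

(** Superlevel sets at r >= 0 are unions of members of [BB], hence open; those at r < 0 are the
    whole space. *)
Lemma measurable_maximal f : measurable_fun setT (maximal BB f).
Proof.
apply: (measurability _ (ErealGenOInfty.measurableE R)) => _ [_ [r ->] <-].
rewrite setTI; have [r0|r0] := ltP r 0%R.
  rewrite [X in measurable X](_ : _ = setT)//; apply/seteqP; split => // x _ /=.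
  by rewrite in_itv/= andbT (lt_le_trans _ (maximal_ge0 f x))// lte_fin.
rewrite [X in measurable X](_ : _ = \bigcup_(B in [set B | BB B /\
    r%:E < average B (fun y => `|(f y)%:E|)]) B).
  by apply: rV_open_measurable; apply: bigcup_open => B [/openBB].
apply/seteqP; split => [x /=|x [B [BBB rB] Bx] /=]; last first.
  by rewrite in_itv/= andbT (lt_le_trans rB)// average_le_maximal.
rewrite in_itv/= andbT => rx; apply: contrapT => xB.
suff : maximal BB f x <= r%:E by rewrite leNgt rx.
apply: maximal_le => // B BBB Bx; rewrite leNgt; apply/negP => rB.
by apply: xB; exists B.
Qed.

End maximal_operator.

(** * Weighted norms and operator bounds in p-th powers *)

Section weighted_norms.
Context (R : realType) (n : nat).
Local Open Scope ereal_scope.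
Local Notation mu := (lebesgue_rV R n).
Implicit Types (p : R) (w : 'rV[R]_n -> R) (g : 'rV[R]_n -> \bar R).

(** The p-th power of [wnorm]. Norm inequalities are proved in this form, where integrals add and
    constants come out. *)
Definition wintegral p w g := \int[mu]_x (`|g x| `^ p * (w x)%:E).

Lemma wintegral_ge0 p w g : (forall x, 0 <= w x)%R -> 0 <= wintegral p w g.
Proof. by move=> w0; apply: integral_ge0 => x _; rewrite mule_ge0 ?poweR_ge0 ?lee_fin. Qed.

Lemma wintegral_cst1 p g : wintegral p (cst 1%R) g = \int[mu]_x (`|g x| `^ p).
Proof. by apply: eq_integral => x _; rewrite /= mule1. Qed.

Lemma ge0_le_poweR (r : R) (x y : \bar R) : (0 <= r)%R -> 0 <= x -> x <= y ->
  x `^ r <= y `^ r.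
Proof.
move=> r0 x0 xy; apply: gt0_ler_poweR => //; rewrite in_itv/= ?leey ?andbT//.
exact: le_trans xy.
Qed.

Lemma le_wnorm p w (g h : 'rV[R]_n -> \bar R) (C : R) : (0 < p)%R ->
  (0 <= C)%R -> (forall x, 0 <= w x)%R ->
  (wnorm p w g <= C%:E * wnorm p w h) =
  (wintegral p w g <= (C `^ p)%:E * wintegral p w h).
Proof.
move=> p0 C0 w0; rewrite /wnorm -!/(wintegral _ _ _).
have [g0 h0] : 0 <= wintegral p w g /\ 0 <= wintegral p w h.
  by split; exact: wintegral_ge0.
have CE : C%:E = (C `^ p)%:E `^ p^-1.
  by rewrite poweR_EFin -powRrM mulfV ?gt_eqF// powRr1.
have p'0 : (0 <= p^-1)%R by rewrite invr_ge0 ltW.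
rewrite CE -poweRM ?lee_fin ?powR_ge0//.
apply/idP/idP => [|gh]; last exact: ge0_le_poweR.
move/(ge0_le_poweR (ltW p0) (poweR_ge0 _ _)).
by rewrite -!poweRrM mulVf ?gt_eqF// !poweRe1// mule_ge0 ?lee_fin ?powR_ge0.
Qed.

Lemma wnorm_lty p w g : (0 < p)%R ->
  (wnorm p w g < +oo) = (wintegral p w g < +oo).
Proof.
move=> p0; apply/idP/idP => [|goo]; last exact: poweR_lty.
by apply: lty_poweRy; rewrite gt_eqF// invr_gt0.
Qed.

Lemma operator_boundP (T : ('rV[R]_n -> R) -> 'rV[R]_n -> \bar R) p w C :
  (0 < p)%R -> (forall x, 0 <= w x)%R -> operator_bound T p w C <->
  (0 <= C)%R /\ forall f, measurable_fun setT f ->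
    wintegral p w (EFin \o f) < +oo ->
    wintegral p w (T f) <= (C `^ p)%:E * wintegral p w (EFin \o f).
Proof.
move=> p0 w0; split=> -[C0 TC]; split=> // f.
  by move=> mf foo; rewrite -le_wnorm//; apply: TC; split; rewrite ?wnorm_lty.
by move=> [mf]; rewrite wnorm_lty// le_wnorm//; exact: TC.
Qed.

Lemma operator_bound_le (T : ('rV[R]_n -> R) -> 'rV[R]_n -> \bar R) p w C D :
  operator_bound T p w C -> (C <= D)%R -> operator_bound T p w D.
Proof.
move=> [C0 TC] CD; split=> [|f fw]; first exact: le_trans CD.
by rewrite (le_trans (TC f fw))// lee_wpmul2r ?poweR_ge0// lee_fin.
Qed.

Lemma operator_norm_ge0 (T : ('rV[R]_n -> R) -> 'rV[R]_n -> \bar R) p w :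
  0 <= operator_norm T p w.
Proof. by apply: le_ereal_inf_tmp => _ [C [C0 _] <-]; rewrite lee_fin. Qed.

(** The strict inequality yields an admissible constant below [C], so it does not matter whether the
    infimum is attained. *)
Lemma operator_norm_lt (T : ('rV[R]_n -> R) -> 'rV[R]_n -> \bar R) p w C :
  operator_norm T p w < C%:E -> operator_bound T p w C.
Proof.
move=> /ereal_inf_lt[_ [D TD <-]]; rewrite lte_fin => /ltW.
exact: operator_bound_le.
Qed.

Lemma operator_norm_le (T : ('rV[R]_n -> R) -> 'rV[R]_n -> \bar R) p w C :
  operator_bound T p w C -> operator_norm T p w <= C%:E.
Proof. by move=> TC; apply: ereal_inf_lbound; exists C. Qed.

End weighted_norms.

Lemma nneseries_half_le (R : realType) (y : \bar R) : (0 <= y)%E ->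
  (\sum_(k <oo) ((2^-1 ^+ k)%:E * y) <= 2%:E * y)%E.
Proof.
case: y => [y|_|//]; last by rewrite gt0_muley ?lte_fin// leey.
rewrite lee_fin => y0; rewrite -EFinM.
(* [epsilon_trick0] bounds the sum of eps / 2^(k+1) by eps; here eps = 2y. *)
have := @epsilon_trick0 R (2 * y) xpredT; rewrite mulr_ge0// => /(_ erefl).
apply: le_trans; apply: lee_nneseries => k _; rewrite -EFinM ?lee_fin.
  by rewrite mulr_ge0// exprn_ge0.
rewrite natrX exprS exprVn le_eqVlt; apply/orP; left; apply/eqP.
by field; rewrite expf_neq0// pnatr_eq0.
Qed.

Lemma measurable_fun_poweR d (T : measurableType d) (R : realType) (D : set T)
    (g : T -> \bar R) (r : R) :
  measurable_fun D g -> measurable_fun D (fun x => g x `^ r)%E.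
Proof. by move=> mg; apply: (measurableT_comp (measurable_poweR r) mg). Qed.

(** * The Rubio de Francia function: majorant, norm, averages *)

Section rubio_de_francia.
Context (R : realType) (n : nat) (BB : set (set 'rV[R]_n)).
Hypothesis openBB : forall B, BB B -> open B.
Local Open Scope ereal_scope.
Local Notation mu := (lebesgue_rV R n).
Context (p N : R).
Hypotheses (p1 : (1 < p)%R) (N1 : (1 <= N)%R).
Hypothesis boundN : operator_bound (maximal BB) p (cst 1%R) N.
Context (f : 'rV[R]_n -> R).
Hypothesis mf : measurable_fun setT f.
Local Notation F := (\int[mu]_x (`|(f x)%:E| `^ p)).
Hypothesis Foo : F < +oo.

Let p0 : (0 < p)%R. Proof. by rewrite (lt_trans _ p1). Qed.
Let N0 : (0 < N)%R. Proof. by rewrite (lt_le_trans _ N1). Qed.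

(* [maximal] takes real-valued functions; [fine] changes the (k+1)-st iterate
   only where it is +oo, a null set by [iterate_maximal_ae]. *)
Fixpoint iterate_maximal (k : nat) : 'rV[R]_n -> R :=
  if k is k'.+1 then fun x => fine (maximal BB (iterate_maximal k') x)
  else fun x => `|f x|%R.
Local Notation fk := iterate_maximal.

Lemma measurable_iterate_maximal k : measurable_fun setT (fk k).
Proof.
elim: k => [|k IH] /=; first exact: measurableT_comp.
by apply: measurableT_comp; [exact: fine_measurable|exact: measurable_maximal].
Qed.

Lemma iterate_maximal_ge0 k x : (0 <= fk k x)%R.
Proof. by case: k => [|k] //=; rewrite fine_ge0// maximal_ge0. Qed.

Lemma iterate_maximal_norm k :
  \int[mu]_x (`|(fk k x)%:E| `^ p) <= ((N `^ p) ^+ k)%:E * F.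
Proof.
elim: k => [|k IH].
  rewrite expr0 mul1e le_eqVlt; apply/orP; left; apply/eqP.
  by apply: eq_integral => x _ /=; rewrite normr_id.
have [_ /(_ (fk k) (measurable_iterate_maximal k))] :=
  (operator_boundP (maximal BB) N p0 (fun=> ler01)).1 boundN.
rewrite !wintegral_cst1 => MN; apply: (@le_trans _ _
    (\int[mu]_x (`|maximal BB (fk k) x| `^ p))).
  apply: ge0_le_integral => // [x _||| x _]; first exact: poweR_ge0.
  - apply: measurable_fun_poweR.
    apply: measurableT_comp => //; apply: measurableT_comp => //.
    exact: (measurable_iterate_maximal k.+1).
  - apply: measurable_fun_poweR.
    by apply: measurableT_comp => //; exact: measurable_maximal.
  (* [fine] sends +oo to 0, so it can only lower the integrand. *)
  - apply: ge0_le_poweR; [exact: ltW|exact: abse_ge0|].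
    by rewrite /=; case: (maximal BB (fk k) x) => //=; rewrite normr0 leey.
have INF : ((N `^ p) ^+ k)%:E * F < +oo.
  by rewrite lte_mul_pinfty// lee_fin exprn_ge0// powR_ge0.
rewrite (le_trans (MN (le_lt_trans IH INF)))// exprS EFinM -muleA.
by rewrite lee_wpmul2l// lee_fin powR_ge0.
Qed.

(** The p-th power of each M f_k has finite integral, so M f_k is finite almost everywhere; the
    countably many exceptional sets are joined into one. *)
Lemma iterate_maximal_ae :
  {ae mu, forall x k, maximal BB (fk k) x = (fk k.+1 x)%:E}.
Proof.
suff H k : {ae mu, forall x, maximal BB (fk k) x = (fk k.+1 x)%:E}.
  exact: ae_foralln H.
have mM : measurable_fun setT (fun x => maximal BB (fk k) x `^ p).
  by apply: measurable_fun_poweR; exact: measurable_maximal.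
have : mu.-integrable setT (fun x => maximal BB (fk k) x `^ p).
  apply/integrableP; split => //.
  have [_ /(_ (fk k) (measurable_iterate_maximal k))] :=
    (operator_boundP (maximal BB) N p0 (fun=> ler01)).1 boundN.
  rewrite !wintegral_cst1 => MN.
  under eq_integral do rewrite gee0_abs ?poweR_ge0//.
  under [X in X < _]eq_integral do rewrite -[maximal BB _ _]gee0_abs ?maximal_ge0//.
  have INF : \int[mu]_x (`|(fk k x)%:E| `^ p) < +oo.
    rewrite (le_lt_trans (iterate_maximal_norm k))//.
    by rewrite lte_mul_pinfty// lee_fin exprn_ge0// powR_ge0.
  by rewrite (le_lt_trans (MN INF))// lte_mul_pinfty// lee_fin powR_ge0.
move=> /(integrable_ae measurableT); apply: filterS => x /(_ I) fin_x /=.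
rewrite fineK// ge0_fin_numE ?maximal_ge0//.
by apply: (@lty_poweRy _ _ p); rewrite ?gt_eqF// ltey_eq fin_x.
Qed.

(* The factor 4N, instead of the usual 2N, gives room to bound the L^p norm
   without Minkowski's inequality. *)
Definition rubio_de_francia x := \sum_(k <oo) (((4 * N) ^- k)%:E * (fk k x)%:E).
Local Notation S := rubio_de_francia.

Let term_ge0 k x : 0 <= ((4 * N) ^- k)%:E * (fk k x)%:E.
Proof.
by rewrite mule_ge0 ?lee_fin ?iterate_maximal_ge0// invr_ge0 exprn_ge0// mulr_ge0// ltW.
Qed.

Let measurable_term k :
  measurable_fun setT (fun x => ((4 * N) ^- k)%:E * (fk k x)%:E).
Proof.
apply: measurable_funeM; apply: measurableT_comp => //.
exact: measurable_iterate_maximal.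
Qed.

Lemma rubio_de_francia_ge0 x : 0 <= S x.
Proof. exact: nneseries_ge0. Qed.

Lemma measurable_rubio_de_francia : measurable_fun setT S.
Proof. exact: ge0_emeasurable_sum. Qed.

Lemma le_rubio_de_francia x : (`|f x|)%:E <= S x.
Proof.
rewrite /S; apply: le_trans (nneseries_lim_ge 1 (fun k _ _ => term_ge0 k x)).
by rewrite big_nat1 expr0 invr1 mul1e.
Qed.

(** The coefficient (4N)^-k is split as 2^-k (2N)^-k. The first factor pays for bounding the sum
    pointwise by an l^p norm of the remaining terms, the second beats the growth N^k of the norms of
    the iterates. *)
Lemma rubio_de_francia_norm :
  \int[mu]_x (S x `^ p) <= (2 `^ p * 2)%:E * F.
Proof.
pose e k x := (((2 * N) ^- k)%:E * (fk k x)%:E) `^ p.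
pose E x := \sum_(k <oo) e k x.
have e0 k x : 0 <= e k x by exact: poweR_ge0.
have t0 k x : 0 <= ((2 * N) ^- k)%:E * (fk k x)%:E.
  by rewrite mule_ge0 ?lee_fin ?iterate_maximal_ge0// invr_ge0 exprn_ge0// mulr_ge0// ltW.
have me k : measurable_fun setT (e k).
  apply: measurable_fun_poweR.
  apply: measurable_funeM; apply: measurableT_comp => //.
  exact: measurable_iterate_maximal.
have SE x : S x `^ p <= (2 `^ p)%:E * E x.
  have E0 : 0 <= E x by exact: nneseries_ge0.
  (* Each (e_k)^(1/p) is at most E^(1/p), and the coefficients 2^-k sum to 2. *)
  have Sx : S x <= 2%:E * E x `^ p^-1.
    apply: le_trans (nneseries_half_le (poweR_ge0 _ _)).
    apply: lee_nneseries => [k _ _|k _]; first exact: term_ge0.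
    have -> : ((4 * N) ^- k = 2^-1 ^+ k * (2 * N) ^- k)%R.
      by rewrite -!exprVn -exprMn -invfM; congr (_^-1 ^+ _)%R; ring.
    rewrite EFinM -muleA lee_wpmul2l ?lee_fin ?exprn_ge0//.
    have -> : ((2 * N) ^- k)%:E * (fk k x)%:E = (e k x) `^ p^-1.
      by rewrite -poweRrM mulfV ?gt_eqF// poweRe1.
    apply: ge0_le_poweR => //; first by rewrite invr_ge0 ltW.
    apply: le_trans (nneseries_lim_ge k.+1 (fun k _ _ => e0 k x)).
    by rewrite big_nat_recr//= leeDr// sume_ge0.
  rewrite (le_trans (ge0_le_poweR (ltW p0) (rubio_de_francia_ge0 x) Sx))//.
  by rewrite poweRM ?poweR_ge0// poweR_EFin -poweRrM mulVf ?gt_eqF// poweRe1.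
have mE : measurable_fun setT E by exact: ge0_emeasurable_sum.
have E0 x : 0 <= E x by exact: nneseries_ge0.
apply: (@le_trans _ _ (\int[mu]_x ((2 `^ p)%:E * E x))).
  apply: ge0_le_integral => //.
  - by move=> x _; exact: poweR_ge0.
  - apply: measurable_fun_poweR.
    exact: measurable_rubio_de_francia.
  - exact: measurable_funeM.
rewrite ge0_integralZl ?lee_fin ?powR_ge0// EFinM -muleA.
rewrite lee_wpmul2l ?lee_fin ?powR_ge0// integral_nneseries//.
apply: le_trans (nneseries_half_le _); last first.
  by apply: integral_ge0 => x _; exact: poweR_ge0.
apply: lee_nneseries => [k _ _|k _]; first by apply: integral_ge0 => x _; exact: e0.
have -> : \int[mu]_x e k x =
    (((2 * N) ^- k) `^ p)%:E * \int[mu]_x (`|(fk k x)%:E| `^ p).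
  rewrite -ge0_integralZl ?lee_fin ?powR_ge0//.
    apply: eq_integral => x _; rewrite /e poweRM ?lee_fin ?iterate_maximal_ge0//.
      by rewrite gee0_abs// lee_fin iterate_maximal_ge0.
    by rewrite invr_ge0 exprn_ge0// mulr_ge0// ltW.
    apply: measurable_fun_poweR.
    apply: measurableT_comp => //; apply: measurableT_comp => //.
    exact: measurable_iterate_maximal.
  by move=> x _; exact: poweR_ge0.
have c0 : 0 <= (((2 * N) ^- k) `^ p)%:E by rewrite lee_fin powR_ge0.
apply: (le_trans (lee_wpmul2l c0 (iterate_maximal_norm k))).
rewrite muleA -EFinM lee_wpmul2r//; last rewrite lee_fin.
  by apply: integral_ge0 => x _; exact: poweR_ge0.
have N'0 : (0 <= (2 * N)^-1)%R by rewrite invr_ge0 mulr_ge0// ltW.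
have -> : (((2 * N) ^- k) `^ p = ((2 * N)^-1 `^ p) ^+ k)%R.
  by rewrite -exprVn -(powR_mulrn k N'0) -(powR_mulrn k (powR_ge0 _ _)) -!powRrM (mulrC p).
(* N^p cancels and leaves 2^(-p), at most 1/2 because p > 1. *)
rewrite -exprMn lerXn2r ?nnegrE ?mulr_ge0 ?powR_ge0//.
rewrite -powRM ?invr_ge0 ?mulr_ge0 ?(ltW N0)// invfM divfK ?gt_eqF//.
by apply: ge1r_powR; [lra|exact: ltW].
Qed.

(** The average of f_k over [B] is at most M f_k(x) = f_(k+1)(x), and the shift of index costs one
    factor 4N. The exceptional set comes from the iterates alone, so it serves all [B] at once, even
    for an uncountable [BB]. *)
Lemma average_rubio_de_francia :
  {ae mu, forall x B, BB B -> B x -> average B S <= (4 * N)%:E * S x}.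
Proof.
apply: filterS iterate_maximal_ae => x Mx B BBB Bx.
have mB : measurable B by apply: rV_open_measurable; exact: openBB.
have N'0 : (0 < 4 * N)%R by rewrite mulr_gt0.
have c0 k : 0 <= ((4 * N) ^- k)%:E by rewrite lee_fin invr_ge0 exprn_ge0// ltW.
have mfkB k : measurable_fun B (fun y => (fk k y)%:E).
  by apply: measurable_funTS; apply: measurableT_comp => //; exact: measurable_iterate_maximal.
rewrite /S average_nneseries//; last first.
  by move=> k; apply: measurable_funTS; exact: measurable_term.
apply: (@le_trans _ _ (\sum_(k <oo) ((4 * N)%:E *
    (((4 * N) ^- k.+1)%:E * (fk k.+1 x)%:E)))).
  apply: lee_nneseries => [k _ _|k _]; first exact: average_ge0.
  rewrite averageZl//; last by move=> y _; rewrite lee_fin iterate_maximal_ge0.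
  rewrite [leRHS]muleA -[X in _ <= X * _]EFinM.
  have -> : (4 * N * (4 * N) ^- k.+1 = (4 * N) ^- k)%R.
    by rewrite exprS; field; rewrite expf_neq0 ?gt_eqF.
  rewrite lee_wpmul2l//.
  rewrite -Mx; apply: le_trans (average_le_maximal _ BBB Bx).
  rewrite le_eqVlt; apply/orP; left; apply/eqP; congr average.
  by apply/funext => y; rewrite gee0_abs// lee_fin iterate_maximal_ge0.
rewrite nneseriesZl//.
rewrite lee_wpmul2l ?lee_fin ?(ltW N'0)//.
(* The shifted series is that of S x without its nonnegative term k = 0. *)
rewrite [leRHS]nneseries_recl// -(nneseries_addn 1)//.
under [X in _ <= _ + X]eq_eseriesr do rewrite addn1.
by rewrite leeDr.
Qed.


End rubio_de_francia.

(** * The A_q constant of positive weights, from above and from below *)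

Section positive_weights.
Context (R : realType) (n : nat) (BB : set (set 'rV[R]_n)).
Hypothesis openBB : forall B, BB B -> open B.
Local Open Scope ereal_scope.
Local Notation mu := (lebesgue_rV R n).

Lemma ae_exists (B : set 'rV[R]_n) (P : 'rV[R]_n -> Prop) : measurable B ->
  0 < mu B -> {ae mu, forall x, P x} -> exists2 x, B x & P x.
Proof.
move=> mB B0 aeP; apply: contrapT => nP.
suff : mu B = 0 by move=> B00; rewrite B00 ltxx in B0.
apply/(negligibleP mu mB); apply: negligibleS aeP => x Bx /= Px.
by apply: nP; exists x.
Qed.

Lemma average_gt0 (B : set 'rV[R]_n) (f : 'rV[R]_n -> \bar R) :
  measurable B -> 0 < mu B < +oo -> measurable_fun B f ->
  (forall x, B x -> 0 < f x) -> 0 < average B f.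
Proof.
move=> mB /andP[B0 Boo] mf f0.
have f0' x : B x -> 0 <= f x by move=> Bx; exact/ltW/f0.
rewrite lt0e average_ge0// andbT; apply/eqP => avg0.
have : \int[mu]_(x in B) f x = 0.
  move/eqP : avg0; rewrite /average mule_eq0 inve_eq0 => /orP[/eqP//|].
  by rewrite lt_eqF.
have -> : \int[mu]_(x in B) f x = \int[mu]_(x in B) `|f x|.
  by apply: eq_integral => x /set_mem Bx; rewrite gee0_abs// f0'.
move/(ae_eq_integral_abs _ mB mf).1 => /(ae_exists mB B0)[x Bx /(_ Bx) fx0].
by have := f0 x Bx; rewrite fx0 ltxx.
Qed.

Section power_weight.
Context (p q d L : R) (g : 'rV[R]_n -> R).
Hypotheses (p1 : (1 < p)%R) (pq : (p < q)%R) (d0 : (0 < d)%R) (L0 : (0 < L)%R).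
Hypotheses (mg : measurable_fun setT g) (dg : forall x, (d <= g x)%R).
Hypothesis A1g : {ae mu, forall x B, BB B -> B x ->
  average B (EFin \o g) <= (L * g x)%:E}.
Local Notation w := (fun x => g x `^ (p - q))%R.

Let g0 x : (0 < g x)%R. Proof. exact: lt_le_trans (dg x). Qed.
Let pq0 : (p - q < 0)%R. Proof. by rewrite subr_lt0. Qed.
Let q1 : (1 < q)%R. Proof. exact: lt_trans pq. Qed.

Let npowR_le (a b : R) : (0 < a)%R -> (a <= b)%R -> (b `^ (p - q) <= a `^ (p - q))%R.
Proof.
move=> a0 ab; have b0 := lt_le_trans a0 ab.
rewrite -(opprB q p) !powRN lef_pV2 ?posrE ?powR_gt0//.
by rewrite ge0_ler_powR// ?nnegrE ?subr_ge0 ltW.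
Qed.

Let mw : measurable_fun setT w.
Proof. exact: (measurableT_comp (measurable_powR _)). Qed.

(** The exponent p - q is negative, so the lower bound [d] on [g] becomes the upper bound d^(p-q) on
    the weight. *)
Lemma power_weight : weight w.
Proof.
split=> // [x|K /lebesgue_rV_compact[mK Koo]]; first exact: powR_ge0.
apply: (@le_lt_trans _ _ (\int[mu]_(x in K) cst (d `^ (p - q))%:E x)).
  apply: ge0_le_integral => // [x _||x _]; first by rewrite lee_fin powR_ge0.
    by apply: measurable_funTS; apply: measurableT_comp.
  by rewrite lee_fin npowR_le.
by rewrite integral_cst// lte_mul_pinfty// lee_fin powR_ge0.
Qed.

(** Let r be the average of [g] over [B]. The A_1 condition bounds the weight on [B] by (r/L)^(p-q)
    almost everywhere; the dual weight is g^s with 0 <= s <= 1, of average at most 2 r^s. In the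
    product all powers of r cancel. *)
Lemma Ap_constant_power_weight :
  Ap_constant BB q w <= (2 `^ (q - 1) * L `^ (q - p))%:E.
Proof.
apply: ge_ereal_sup => _ [B BBB <-].
have mB : measurable B by apply: rV_open_measurable; exact: openBB.
have rhs0 : 0 <= (2 `^ (q - 1) * L `^ (q - p))%:E.
  by rewrite lee_fin mulr_ge0 ?powR_ge0.
have mwB : measurable_fun B (EFin \o w).
  by apply: measurable_funTS; apply: measurableT_comp.
have mgB : measurable_fun B (EFin \o g).
  by apply: measurable_funTS; apply: measurableT_comp.
have [B0|B0] := eqVneq (mu B) 0.
  by rewrite [X in X * _]average_null ?mul0e//; left.
have [Boo|Boo] := eqVneq (mu B) +oo.
  by rewrite [X in X * _]average_null ?mul0e//; right.
have B0oo : 0 < mu B < +oo by rewrite lt0e B0 measure_ge0 ltey Boo.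
have [Bpos _] := andP B0oo.
(* One point of [B] at which the A_1 condition holds shows that the average of [g] is finite. *)
have [x0 Bx0 /(_ B BBB Bx0) tg] := ae_exists mB Bpos A1g.
set t := average B (EFin \o g) in tg.
have dt : d%:E <= t.
  rewrite -(average_cst d%:E mB B0oo); apply: ae_le_average => //.
  - by move=> x _; rewrite lee_fin ltW.
  - by move=> x _; rewrite lee_fin ltW.
  - by apply: aeW => x _; rewrite lee_fin.
have [r tE] : exists r, t = r%:E.
  by move: tg dt; case: (t) => [r _ _|//|//]; exists r.
rewrite tE lee_fin in dt; have r0 : (0 < r)%R by exact: lt_le_trans dt.
(* Since 1 - q' = -1/(q-1), this is the exponent (p-q)(1-q') of the dual weight. *)
pose s := ((q - p) / (q - 1))%R.
have q10 : (0 < q - 1)%R by rewrite subr_gt0.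
have s01 : (0 <= s <= 1)%R.
  rewrite /s divr_ge0 ?subr_ge0 ?(ltW pq) ?(ltW q1)//= ler_pdivrMr// mul1r.
  by rewrite lerD2l lerN2 ltW.
have wB : average B (EFin \o w) <= ((r / L) `^ (p - q))%:E.
  rewrite -(average_cst ((r / L) `^ (p - q))%:E mB B0oo).
  apply: ae_le_average => //.
  - by move=> x _; rewrite lee_fin powR_ge0.
  - by move=> x _; rewrite lee_fin powR_ge0.
  - apply: filterS A1g => x + Bx => /(_ B BBB Bx); rewrite -/t tE !lee_fin => rLg.
    by apply: npowR_le; [exact: divr_gt0|rewrite ler_pdivrMr// mulrC].
have epowE x : epow (w x) (1 - conjugate_exponent q) = (g x `^ s)%:E.
  rewrite /epow gt_eqF ?powR_gt0//= -powRrM; congr (_ `^ _)%:E.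
  by rewrite /conjugate_exponent /s; field; rewrite gt_eqF.
have vB : average B (fun x => epow (w x) (1 - conjugate_exponent q)) <=
    (2 * r `^ s)%:E.
  under eq_fun do rewrite epowE.
  (* [powR_le_linear] is taken at the average r itself, so that both of its terms average to r^s. *)
  apply: (@le_trans _ _ (average B (fun x => (r `^ s)%:E + (r `^ s / r)%:E * (g x)%:E))).
    apply: ae_le_average => //.
    - apply: measurable_funTS; apply: measurableT_comp => //.
      exact: (measurableT_comp (measurable_powR s)).
    - by apply: emeasurable_funD => //; exact: measurable_funeM.
    - by move=> x _; rewrite lee_fin powR_ge0.
    - by move=> x _; rewrite -EFinM -EFinD lee_fin addr_ge0 ?mulr_ge0 ?powR_ge0 ?invr_ge0// ltW.
    - by apply: aeW => x _; rewrite -EFinM -EFinD lee_fin powR_le_linear.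
  rewrite averageD//; last 3 first.
  - exact: measurable_funeM.
  - by move=> x _; rewrite lee_fin powR_ge0.
  - by move=> x _; rewrite -EFinM lee_fin ?mulr_ge0 ?powR_ge0 ?invr_ge0// ltW.
  rewrite (average_cst (r `^ s)%:E)// averageZl//; last 2 first.
  - by move=> x _; rewrite lee_fin ltW.
  - by rewrite lee_fin mulr_ge0 ?powR_ge0 ?invr_ge0// ltW.
  rewrite -/t tE -EFinM -EFinD lee_fin divfK ?gt_eqF//; lra.
apply: le_trans (lee_pmul _ _ wB (ge0_le_poweR (ltW q10) _ vB)) _.
- by apply: average_ge0 => x _; rewrite lee_fin powR_ge0.
- exact: poweR_ge0.
- by apply: average_ge0 => x _; rewrite epowE lee_fin powR_ge0.
rewrite poweR_EFin -EFinM lee_fin le_eqVlt; apply/orP; left; apply/eqP.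
have -> : ((r / L) `^ (p - q) = r `^ (p - q) * L `^ (q - p))%R.
  rewrite powRM ?invr_ge0 ?(ltW r0) ?(ltW L0)//; congr (_ * _)%R.
  by rewrite -(powR_inv1 (ltW L0)) -powRrM mulN1r opprB.
have -> : ((2 * r `^ s) `^ (q - 1) = 2 `^ (q - 1) * r `^ (q - p))%R.
  by rewrite powRM ?powR_ge0// -powRrM divfK// gt_eqF.
have rr : (r `^ (p - q) * r `^ (q - p) = 1)%R.
  by rewrite -powRD ?(gt_eqF r0) ?implybT// subrKA subrr powRr0.
transitivity ((2 `^ (q - 1) * L `^ (q - p)) * (r `^ (p - q) * r `^ (q - p)))%R.
  by ring.
by rewrite rr mulr1.
Qed.

End power_weight.

(** At every point s w or (s w)^(-e) is at least 1, where e = 1/(q-1); averaging their sum and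
    choosing s gives a weak form of [w] >= 1. It is decisive for negative exponents beta, where
    bounding [w]^beta from above means bounding [w] from below. *)
Lemma Ap_constant_ge (q : R) (w : 'rV[R]_n -> R) (B : set 'rV[R]_n) :
  (1 < q)%R -> measurable_fun setT w -> (forall x, 0 < w x)%R ->
  BB B -> 0 < mu B < +oo -> (2 `^ (- q))%:E <= Ap_constant BB q w.
Proof.
move=> q1 mw w0 BBB B0oo.
have mB : measurable B by apply: rV_open_measurable; exact: openBB.
apply: le_ereal_sup_tmp; exists (average B (EFin \o w) *
    average B (fun x => epow (w x) (1 - conjugate_exponent q)) `^ (q - 1)).
  by exists B.
have q10 : (0 < q - 1)%R by rewrite subr_gt0.
pose e := ((q - 1)^-1)%R; have e0 : (0 < e)%R by rewrite invr_gt0.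
have epowE x : epow (w x) (1 - conjugate_exponent q) = (w x `^ (- e))%:E.
  rewrite /epow gt_eqF//=; congr (_ `^ _)%:E.
  by rewrite /conjugate_exponent /e; field; rewrite gt_eqF.
under eq_fun do rewrite epowE.
have mwB : measurable_fun B (EFin \o w).
  by apply: measurable_funTS; apply: measurableT_comp.
have mvB : measurable_fun B (fun x => (w x `^ (- e))%:E).
  apply: measurable_funTS; apply: measurableT_comp => //.
  exact: (measurableT_comp (measurable_powR (- e))).
have : 0 < average B (EFin \o w) by apply: average_gt0 => // x _; rewrite lte_fin.
have : 0 < average B (fun x => (w x `^ (- e))%:E).
  by apply: average_gt0 => // x _; rewrite lte_fin powR_gt0.
have AM s : (0 < s)%R -> 1 <= s%:E * average B (EFin \o w) +
    (s `^ (- e))%:E * average B (fun x => (w x `^ (- e))%:E).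
  move=> s0; rewrite -!averageZl//; first last.
  - by rewrite lee_fin ltW.
  - by move=> x _; rewrite lee_fin ltW.
  - by rewrite lee_fin powR_ge0.
  - by move=> x _; rewrite lee_fin powR_ge0.
  rewrite -averageD//; last 4 first.
  - exact: measurable_funeM.
  - exact: measurable_funeM.
  - by move=> x _; rewrite -EFinM lee_fin mulr_ge0 ?ltW.
  - by move=> x _; rewrite -EFinM lee_fin mulr_ge0 ?powR_ge0.
  rewrite -{1}(average_cst 1 mB B0oo); apply: ae_le_average => //.
  - by apply: emeasurable_funD; exact: measurable_funeM.
  - by move=> x _; rewrite -!EFinM -EFinD lee_fin addr_ge0 ?mulr_ge0 ?powR_ge0 ?ltW.
  apply: aeW => x _; rewrite -!EFinM -EFinD lee_fin -powRM ?(ltW s0) ?(ltW (w0 x))//.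
  have sw0 : (0 < s * w x)%R by rewrite mulr_gt0.
  have [sw|sw] := leP 1%R (s * w x)%R; first by rewrite ler_wpDr ?powR_ge0.
  rewrite ler_wpDl ?(ltW sw0)// powRN.
  rewrite -[leLHS]invr1 lef_pV2 ?posrE ?powR_gt0//.
  by have := ge0_ler_powR (ltW e0) (ltW sw0) ler01 (ltW sw); rewrite powR1.
move: AM; set u := average B (EFin \o w); set v := average B _.
(* An infinite average makes the product +oo, since the other factor is positive. *)
case: u => [u|_|//]; case: v => [v|_|//]; last 3 first.
- by move=> _ u0; rewrite poweRyr ?gt_eqF// gt0_muley ?leey.
- by move=> v0 _; rewrite gt0_mulye ?leey// poweR_gt0.
- by rewrite poweRyr ?gt_eqF// gt0_mulye ?leey.
rewrite !lte_fin => AM v0 u0; rewrite poweR_EFin -EFinM lee_fin.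
(* With this s, s u = 1/2, so the other term is at least 1/2; the power q - 1 and a division by 2
   then give 2^-q. *)
have s0 : (0 < (2 * u)^-1)%R by rewrite invr_gt0 mulr_gt0.
have := AM _ s0; rewrite -!EFinM -EFinD lee_fin.
have -> : ((2 * u)^-1 * u = 2^-1)%R by field; rewrite gt_eqF.
have -> : ((2 * u)^-1 `^ (- e) = (2 * u) `^ e)%R.
  by rewrite -powR_inv1 ?mulr_ge0 ?(ltW u0)// -powRrM mulN1r opprK.
move=> h; have {}h : (2^-1 <= (2 * u) `^ e * v)%R by lra.
have half0 : (0 <= 2^-1 :> R)%R by rewrite invr_ge0.
have rhs0 : (0 <= (2 * u) `^ e * v)%R by rewrite mulr_ge0 ?powR_ge0// ltW.
have := ge0_ler_powR (ltW q10) half0 rhs0 h.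
rewrite powRM ?powR_ge0 ?(ltW v0)// -powRrM mulVf ?gt_eqF// powRr1; last first.
  by rewrite mulr_ge0 ?ltW.
rewrite -powR_inv1// -powRrM mulN1r opprB.
have -> : (2 `^ (1 - q) = 2 * 2 `^ (- q) :> R)%R.
  by rewrite powRD ?pnatr_eq0 ?implybT// powRr1.
by rewrite -mulrA ler_pM2l.
Qed.

End positive_weights.

(** * From bounds on weighted L^q to a bound on L^p *)

Section extrapolation.
Context (R : realType) (n : nat) (BB : set (set 'rV[R]_n)).
Hypothesis openBB : forall B, BB B -> open B.
Local Open Scope ereal_scope.
Local Notation mu := (lebesgue_rV R n).

Section fixed_function.
Context (p q N A : R).
Hypotheses (p1 : (1 < p)%R) (pq : (p < q)%R) (N1 : (1 <= N)%R) (A0 : (0 < A)%R).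
Hypothesis boundN : operator_bound (maximal BB) p (cst 1%R) N.
Hypothesis boundA : forall w, weight w -> (forall x, 0 < w x)%R ->
  Ap_constant BB q w <= (2 `^ (q - 1) * (4 * N + 1) `^ (q - p))%:E ->
  operator_bound (maximal BB) q w A.
Context (f : 'rV[R]_n -> R).
Hypothesis mf : measurable_fun setT f.
Local Notation F := (\int[mu]_x (`|(f x)%:E| `^ p)).
Hypothesis Foo : F < +oo.

Let p0 : (0 < p)%R. Proof. by rewrite (lt_trans _ p1). Qed.
Let q0 : (0 < q)%R. Proof. by rewrite (lt_trans _ pq). Qed.
Let N0 : (0 < N)%R. Proof. by rewrite (lt_le_trans _ N1). Qed.
Let F0 : 0 <= F. Proof. by apply: integral_ge0 => x _; exact: poweR_ge0. Qed.

Local Notation S := (rubio_de_francia BB N f).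
Let S0 x : 0 <= S x. Proof. exact: rubio_de_francia_ge0. Qed.
Let mS : measurable_fun setT S. Proof. exact: measurable_rubio_de_francia. Qed.
Let mM : measurable_fun setT (maximal BB f). Proof. exact: measurable_maximal. Qed.
Let mMp r : measurable_fun setT (fun x => `|maximal BB f x| `^ r).
Proof. by apply: measurable_fun_poweR; exact: measurableT_comp. Qed.
Let mfp r : measurable_fun setT (fun x => `|(f x)%:E| `^ r).
Proof.
by apply: measurable_fun_poweR; apply: measurableT_comp => //; exact: measurableT_comp.
Qed.

Let S_fin : {ae mu, forall x, S x \is a fin_num}.
Proof.
have mSp : measurable_fun setT (fun x => S x `^ p) by exact: measurable_fun_poweR.
have : mu.-integrable setT (fun x => S x `^ p).
  apply/integrableP; split => //.
  under eq_integral do rewrite gee0_abs ?poweR_ge0//.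
  apply: le_lt_trans (rubio_de_francia_norm openBB p1 N1 boundN mf Foo) _.
  by rewrite lte_mul_pinfty// lee_fin mulr_ge0 ?powR_ge0.
move=> /(integrable_ae measurableT); apply: filterS => x /(_ I) fin_x.
rewrite ge0_fin_numE//.
by apply: (@lty_poweRy _ _ p); rewrite ?gt_eqF// ltey_eq fin_x.
Qed.

Let avgS := average_rubio_de_francia openBB p1 N1 boundN mf Foo.

Let fine_S_le x : (fine (S x))%:E <= S x.
Proof. by have := S0 x; case: (S x). Qed.

(** Where S >= d, the majorant [g] equals S almost everywhere, and S^p is integrable. Elsewhere g =
    d, a constant whose p-th power need not be integrable; hence the restriction, with a bound free
    of [d]. *)
Let restricted_bound (d : R) : (0 < d)%R ->
  \int[mu]_(x in [set x | (d <= fine (S x))%R]) (`|maximal BB f x| `^ p) <=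
  (A `^ p * (2 `^ p * 2 + 1))%:E * F.
Proof.
move=> d0; set D := [set x | _].
have mfS : measurable_fun setT (fun x => fine (S x)).
  by apply: measurableT_comp => //; exact: fine_measurable.
have mD : measurable D.
  rewrite /D -[X in measurable X]setTI.
  exact: (@measurable_fun_le _ _ _ _ (cst d) (fun x => fine (S x))).
pose g x := Num.max (fine (S x)) d.
have mg : measurable_fun setT g by exact: measurable_maxr.
have dg x : (d <= g x)%R by rewrite /g le_max lexx orbT.
have g0 x : (0 < g x)%R by exact: lt_le_trans (dg x).
(* avg g <= avg S + d <= 4N S + d, and both S and d are at most g almost everywhere. *)
have A1g : {ae mu, forall x B, BB B -> B x ->
    average B (EFin \o g) <= ((4 * N + 1) * g x)%:E}.
  apply: filterS2 S_fin avgS => x Sx avgx B BBB Bx.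
  have mB : measurable B by apply: rV_open_measurable; exact: openBB.
  apply: (@le_trans _ _ (average B (fun y => S y + cst d%:E y))).
    apply: ae_le_average => //.
    - by apply: measurable_funTS; exact: measurableT_comp.
    - by apply: measurable_funTS; exact: emeasurable_funD.
    - by move=> y _; rewrite lee_fin ltW.
    - by move=> y _; rewrite adde_ge0// lee_fin ltW.
    apply: aeW => y _; rewrite /= /g EFin_max ge_max; apply/andP; split.
      by rewrite (le_trans (fine_S_le y))// leeDl// lee_fin ltW.
    by rewrite leeDr.
  rewrite averageD//; last 2 first.
  - exact: measurable_funTS.
  - by move=> y _; rewrite lee_fin ltW.
  rewrite mulrDl mul1r EFinD; apply: leeD; last first.
    apply: le_trans (average_cst_le mB _) _; first by rewrite lee_fin ltW.
    by rewrite lee_fin.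
  rewrite (le_trans (avgx B BBB Bx))// [leRHS]EFinM lee_wpmul2l//.
    by rewrite lee_fin mulr_ge0// ltW.
  by rewrite -(fineK Sx) lee_fin /g le_max lexx.
have L0 : (0 < 4 * N + 1)%R by rewrite addr_gt0// mulr_gt0.
pose w x := (g x `^ (p - q))%R.
have w0 x : (0 < w x)%R by exact: powR_gt0.
have mw : measurable_fun setT w by exact: (measurableT_comp (measurable_powR _)).
have mwE : measurable_fun setT (fun x => (w x)%:E) by exact: measurableT_comp.
have wA : operator_bound (maximal BB) q w A.
  apply: boundA => //; first exact: (power_weight pq d0 mg dg).
  exact: (Ap_constant_power_weight openBB p1 pq d0 L0 mg dg A1g).
(* |f| <= S <= g wherever S is finite, so [powR_shift_le] applies to |f|. *)
have fwF : wintegral q w (EFin \o f) <= F.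
  apply: ae_ge0_le_integral => //.
  - by move=> x _; rewrite mule_ge0 ?poweR_ge0 ?lee_fin ?(ltW (w0 x)).
  - exact: emeasurable_funM.
  - by move=> x _; exact: poweR_ge0.
  apply: filterS S_fin => x Sx _; rewrite /= -EFinM lee_fin.
  apply: powR_shift_le => //; rewrite /g le_max; apply/orP; left.
  by rewrite -lee_fin fineK// le_rubio_de_francia.
have [_ /(_ f mf (le_lt_trans fwF Foo)) MwF] :=
  (operator_boundP (maximal BB) A q0 (fun x => ltW (w0 x))).1 wA.
have mMw : measurable_fun setT (fun x => `|maximal BB f x| `^ q * (w x)%:E).
  exact: emeasurable_funM.
(* The split at A g, with g replaced by S on [D]; this is what permits enlarging [D] to the whole
   space afterwards. *)
apply: (@le_trans _ _ (\int[mu]_(x in D) ((A `^ p)%:E * S x `^ p +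
    (A `^ (p - q))%:E * (`|maximal BB f x| `^ q * (w x)%:E)))).
  apply: ae_ge0_le_integral => //.
  - by move=> x _; exact: poweR_ge0.
  - exact: measurable_funTS.
  - move=> x _; rewrite adde_ge0// mule_ge0 ?lee_fin ?powR_ge0 ?poweR_ge0//.
    by rewrite mule_ge0 ?poweR_ge0 ?lee_fin ?powR_ge0.
  - apply: measurable_funTS; apply: emeasurable_funD; apply: measurable_funeM => //.
    exact: measurable_fun_poweR.
  apply: filterS S_fin => x Sx Dx.
  apply: le_trans (powR_split_le (abse_ge0 _) (g0 x) A0 p0 pq) _.
  rewrite leeD2r// powRM ?(ltW A0) ?(ltW (g0 x))// EFinM lee_wpmul2l//.
    by rewrite lee_fin powR_ge0.
  rewrite -poweR_EFin; apply: ge0_le_poweR; [exact: ltW|by rewrite lee_fin ltW|].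
  by rewrite /g max_l.
apply: (@le_trans _ _ (\int[mu]_x ((A `^ p)%:E * S x `^ p +
    (A `^ (p - q))%:E * (`|maximal BB f x| `^ q * (w x)%:E)))).
  apply: ge0_subset_integral => //.
    apply: emeasurable_funD; apply: measurable_funeM => //.
    exact: measurable_fun_poweR.
  move=> x _; rewrite adde_ge0// mule_ge0 ?lee_fin ?powR_ge0 ?poweR_ge0//.
  by rewrite mule_ge0 ?poweR_ge0 ?lee_fin ?powR_ge0.
have Mw0 x : 0 <= `|maximal BB f x| `^ q * (w x)%:E.
  by rewrite mule_ge0 ?poweR_ge0 ?lee_fin ?powR_ge0.
have Ap0 r : 0 <= (A `^ r)%:E by rewrite lee_fin powR_ge0.
rewrite ge0_integralD//; last 4 first.
- by move=> x _; rewrite mule_ge0 ?poweR_ge0.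
- by apply: measurable_funeM; exact: measurable_fun_poweR.
- by move=> x _; rewrite mule_ge0.
- exact: measurable_funeM.
rewrite ge0_integralZl//; last 2 first.
- exact: measurable_fun_poweR.
- by move=> x _; exact: poweR_ge0.
rewrite ge0_integralZl//.
rewrite mulrDr EFinD ge0_muleDl ?lee_fin ?mulr_ge0 ?powR_ge0//; apply: leeD.
  rewrite EFinM -muleA lee_wpmul2l//.
  exact: (rubio_de_francia_norm openBB p1 N1 boundN mf Foo).
(* A^q from the weighted bound meets A^(p-q) from the split and leaves A^p. *)
rewrite mulr1; apply: (@le_trans _ _ ((A `^ (p - q))%:E * ((A `^ q)%:E * F))).
  by rewrite lee_wpmul2l// (le_trans MwF)// lee_wpmul2l.
by rewrite muleA -EFinM -powRD ?(gt_eqF A0) ?implybT// subrK.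
Qed.

(** The sets where S >= 1/(k+1) increase, and monotone convergence handles their union. Almost
    everywhere outside it S = 0, so the estimate on averages of S forces every average of |f|, and
    thus M f, to vanish there. *)
Lemma maximal_norm_le :
  \int[mu]_x (`|maximal BB f x| `^ p) <= (A `^ p * (2 `^ p * 2 + 1))%:E * F.
Proof.
pose D k := [set x | (k.+1%:R^-1 <= fine (S x))%R].
have mfS : measurable_fun setT (fun x => fine (S x)).
  by apply: measurableT_comp => //; exact: fine_measurable.
have mD k : measurable (D k).
  rewrite /D -[X in measurable X]setTI.
  exact: (@measurable_fun_le _ _ _ _ (cst (k.+1%:R^-1)%R) (fun x => fine (S x))).
have -> : \int[mu]_x (`|maximal BB f x| `^ p) =
    \int[mu]_(x in \bigcup_k D k) (`|maximal BB f x| `^ p).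
  rewrite [RHS]integral_mkcond; apply: ge0_ae_eq_integral => //.
  - apply/(measurable_restrictT _ _).1 => //; first exact: bigcup_measurable.
    exact: measurable_funTS.
  - by move=> x _; exact: poweR_ge0.
  - by move=> x _; apply: erestrict_ge0 => y _; exact: poweR_ge0.
  apply: filterS2 S_fin avgS => x Sx avgx _.
  rewrite patchE; case: ifPn => // /negP xD.
  suff -> : maximal BB f x = 0 by rewrite abse0 poweR0r// gt_eqF.
  have Sx0 : S x = 0.
    apply/eqP; rewrite eq_le S0 andbT -(fineK Sx) lee_fin leNgt; apply/negP => fS0.
    (* For k the integer part of 1/S x, k + 1 exceeds 1/S x. *)
    apply: xD; rewrite inE; exists (Num.truncn (fine (S x))^-1%R) => //.
    rewrite /D /= invf_ple ?posrE//; apply/ltW.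
    by rewrite truncnS_gt.
  apply/eqP; rewrite eq_le maximal_ge0 andbT; apply: maximal_le => // B BBB Bx.
  have mB : measurable B by apply: rV_open_measurable; exact: openBB.
  have := avgx B BBB Bx; rewrite Sx0 mule0; apply: le_trans.
  apply: ae_le_average => //.
  - by apply: measurable_funTS; do 2 apply: measurableT_comp => //.
  - exact: measurable_funTS.
  - by apply: aeW => y _; exact: le_rubio_de_francia.
apply: (cvge_to_le (ge0_nondecreasing_set_cvg_integral _ mD _ _)).
- move=> k l kl; apply/subsetPset => x; apply: le_trans.
  by rewrite lef_pV2 ?posrE// ler_nat.
- by move=> k; exact: measurable_funTS.
- by move=> k x _; exact: poweR_ge0.
- by apply: nearW => k; apply: restricted_bound; rewrite invr_gt0.
Qed.

End fixed_function.

(** With K = 2^(p+1) + 1 >= 1 and p > 1, A^p K <= (A K)^p. The resulting bound is linear in [A], so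
    sublinear growth of [A] in [N] survives. *)
Lemma extrapolation (p q N A : R) :
  (1 < p)%R -> (p < q)%R -> (1 <= N)%R -> (0 < A)%R ->
  operator_bound (maximal BB) p (cst 1%R) N ->
  (forall w, weight w -> (forall x, 0 < w x)%R ->
    Ap_constant BB q w <= (2 `^ (q - 1) * (4 * N + 1) `^ (q - p))%:E ->
    operator_bound (maximal BB) q w A) ->
  operator_bound (maximal BB) p (cst 1%R) (A * (2 `^ p * 2 + 1)).
Proof.
move=> p1 pq N1 A0 boundN boundA; have p0 := lt_trans ltr01 p1.
have K1 : (1 <= 2 `^ p * 2 + 1 :> R)%R by rewrite lerDr mulr_ge0 ?powR_ge0.
apply/operator_boundP => //; split.
  by rewrite mulr_ge0 ?(ltW A0)// (le_trans _ K1).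
move=> f mf; rewrite !wintegral_cst1 => Foo.
apply: le_trans (maximal_norm_le p1 pq N1 A0 boundN boundA mf Foo) _.
rewrite lee_wpmul2r//; first by apply: integral_ge0 => x _; exact: poweR_ge0.
rewrite lee_fin powRM ?(ltW A0) ?(le_trans _ K1)// ler_wpM2l ?powR_ge0//.
by rewrite le1r_powR// ltW.
Qed.

End extrapolation.

(** * Growth of the weighted norms, uniformly in p *)

Section growth.
Context (R : realType) (n : nat) (BB : set (set 'rV[R]_n)).
Hypothesis openBB : forall B, BB B -> open B.
Local Open Scope ereal_scope.
Local Notation mu := (lebesgue_rV R n).

Lemma weight_cst1 : weight (cst 1%R : 'rV[R]_n -> R).
Proof.
split=> // K /lebesgue_rV_compact[mK Koo].
by rewrite -[X in X < _]/(\int[mu]_(x in K) cst 1 x) integral_cst// mul1e.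
Qed.

(** Through the Muckenhoupt property this makes the norm on unweighted L^p finite for each p > 1,
    without uniformity in p. *)
Lemma Ap_cst1 (p : R) : (1 < p)%R -> Ap BB p (cst 1%R).
Proof.
move=> p1; split; first exact: weight_cst1.
apply: (@le_lt_trans _ _ 1); last exact: ltry.
apply: ge_ereal_sup => _ [B BBB <-].
have mB : measurable B by apply: rV_open_measurable; exact: openBB.
have -> : (fun x : 'rV[R]_n => epow (cst 1%R x) (1 - conjugate_exponent p)) = cst 1.
  by apply/funext => x; rewrite /epow /= oner_eq0/= powR1.
have avg1 : average B (cst 1) <= 1 by exact: average_cst_le.
have avg0 : 0 <= average B (cst 1) by exact: average_ge0.
rewrite -[leRHS]mule1; apply: lee_pmul => //; first exact: poweR_ge0.
by rewrite -[leRHS](poweR1r (p - 1)); apply: ge0_le_poweR => //; rewrite subr_ge0 ltW.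
Qed.

(** [X] stands for 4N + 1. If some member of [BB] has finite positive measure, so that
    [Ap_constant_ge] applies, [t] is max(0, (q-1) beta), which is below 1 because beta < 1/(q-1).
    Since X >= 1, X^(q-p) <= X^(q-1) removes the dependence on p. *)
Lemma weighted_norm_growth (q beta c : R) : (1 < q)%R ->
  (forall w, Ap BB q w ->
    operator_norm (maximal BB) q w <= c%:E * Ap_constant BB q w `^ beta) ->
  (beta < 1 / (q - 1))%R ->
  exists a t, [/\ (0 <= a)%R, (0 <= t < 1)%R & forall p X w,
    (1 < p < q)%R -> (1 <= X)%R -> weight w -> (forall x, 0 < w x)%R ->
    Ap_constant BB q w <= (2 `^ (q - 1) * X `^ (q - p))%:E ->
    operator_norm (maximal BB) q w <= (a * X `^ t)%:E].
Proof.
move=> q1 normle betaq; have q10 : (0 < q - 1)%R by rewrite subr_gt0.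
have [[B [BBB B0oo]]|noB] := pselect (exists B, BB B /\ 0 < mu B < +oo); last first.
  (* Then M = 0. *)
  have average0 (f : 'rV[R]_n -> R) (B : set 'rV[R]_n) : BB B ->
      measurable_fun setT f -> average B (fun y => `|(f y)%:E|) = 0.
    move=> BBB mf; apply: average_null.
    - by apply: rV_open_measurable; exact: openBB.
    - by apply: measurable_funTS; do 2 apply: measurableT_comp => //.
    have [B0|B0] := eqVneq (mu B) 0; [by left|right; apply: contrapT => Boo].
    apply: noB; exists B; split=> //; rewrite lt0e B0 measure_ge0 ltey.
    exact/eqP.
  exists 0%R, 0%R; rewrite lexx ltr01; split=> // p X w /andP[p1 pq] _ _ w0 _.
  rewrite mul0r.
  have q0 : (0 < q)%R by rewrite (lt_trans _ q1).
  apply/operator_norm_le/operator_boundP => // [x|]; first exact: ltW.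
  split=> // f mf _; rewrite powR0 ?gt_eqF// mul0e.
  rewrite [leLHS](_ : _ = 0)//; apply: integral0_eq => x _.
  rewrite (_ : maximal BB f x = 0) ?abse0 ?poweR0r ?gt_eqF ?mul0e//.
  apply/eqP; rewrite eq_le maximal_ge0 andbT; apply: maximal_le => // B BBB _.
  by rewrite average0.
(* The sign of [c] is open; |c| makes the bound monotone in r^beta. *)
pose C (r : R) := (`|c| * r `^ beta)%R.
have normle' w r : Ap BB q w -> Ap_constant BB q w `^ beta <= (r `^ beta)%:E ->
    operator_norm (maximal BB) q w <= (C r)%:E.
  move=> Aw wr; apply: (le_trans (normle w Aw)).
  apply: (@le_trans _ _ (`|c|%:E * Ap_constant BB q w `^ beta)).
    by rewrite lee_wpmul2r ?poweR_ge0// lee_fin ler_norm.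
  by rewrite /C EFinM lee_wpmul2l.
have wge (w : 'rV[R]_n -> R) : weight w -> (forall x, 0 < w x)%R ->
    (2 `^ (- q))%:E <= Ap_constant BB q w.
  by move=> [mw _ _] w0; exact: Ap_constant_ge B0oo.
have wApX (w : 'rV[R]_n -> R) r : weight w -> Ap_constant BB q w <= r%:E -> Ap BB q w.
  by move=> ww wr; split=> //; exact: le_lt_trans (ltry r).
have [beta0|beta0] := leP 0%R beta.
  exists (C (2 `^ (q - 1)))%R, ((q - 1) * beta)%R; split.
  - by rewrite mulr_ge0 ?powR_ge0.
  - by rewrite mulr_ge0 ?(ltW q10)//= mulrC -ltr_pdivlMr.
  move=> p X w /andP[p1 pq] X1 ww w0 wX; have X0 : (0 <= X)%R by lra.
  apply: le_trans (normle' w (2 `^ (q - 1) * X `^ (q - p))%R (wApX w _ ww wX) _) _.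
    rewrite -poweR_EFin; apply: ge0_le_poweR => //.
    by apply: le_trans (wge w ww w0); rewrite lee_fin powR_ge0.
  rewrite lee_fin /C powRM ?powR_ge0// -!mulrA ler_wpM2l// ler_wpM2l ?powR_ge0//.
  by rewrite -powRrM ler_powR// ler_wpM2r// lerD2l lerN2 ltW.
(* For beta < 0 the power is decreasing, so the lower bound 2^-q on the A_q constant bounds the norm
   independently of [X], and t = 0. *)
exists (C (2 `^ (- q)))%R, 0%R; split=> [||p X w pq X1 ww w0 wX].
- by rewrite mulr_ge0 ?powR_ge0.
- by rewrite lexx ltr01.
rewrite powRr0 mulr1; apply: normle'; first exact: wApX ww wX.
have := wge w ww w0.
case: (Ap_constant BB q w) wX => [r _|//|//]; rewrite lee_fin => qr.
have r0 : (0 < r)%R by apply: lt_le_trans qr; rewrite powR_gt0.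
have betaE x : (x `^ beta = (x `^ (- beta))^-1)%R by rewrite powRN invrK.
rewrite poweR_EFin lee_fin (betaE r) (betaE (2 `^ (- q))%R).
rewrite lef_pV2 ?posrE ?powR_gt0//.
apply: ge0_ler_powR; rewrite ?nnegrE ?oppr_ge0 ?powR_ge0//; exact: ltW.
Qed.

End growth.

(** * Boundedness of the norms as p tends to 1 *)

Theorem theorem6p1 (R : realType) (n : nat) (BB : set (set 'rV[R]_n))
    (p0 beta : R) :
  Muckenhoupt_basis BB ->
  1 < p0 ->
  (exists c : R, forall w : 'rV[R]_n -> R, Ap BB p0 w ->
     (operator_norm (maximal BB) p0 w <=
      c%:E * (Ap_constant BB p0 w) `^ beta)%E) ->
  limf_esup (fun p : R => operator_norm (maximal BB) p (cst 1)) 1^'+ = +oo%E ->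
  1 / (p0 - 1) <= beta.
Proof.
move=> [openBB muckBB] p01 [c normle] limoo; rewrite leNgt; apply/negP => betap.
have [a [t [a0 t01 growth]]] := weighted_norm_growth openBB p01 normle betap.
(* Dominates the factor from [extrapolation] for all p < p0. *)
pose D : R := 2 `^ p0 * 2 + 1.
have D0 : 0 <= D by rewrite addr_ge0// mulr_ge0 ?powR_ge0.
(* What [sublinear_bound] yields from X <= 4 D a X^t + (4 D + 5), which follows from X = 4r + 5 and
   r <= (a X^t + 1) D. *)
pose bound := (4 * (D * a) + (4 * D + 5)) `^ (1 - t)^-1.
have norm_bound p : 1 < p < p0 ->
    (operator_norm (maximal BB) p (cst 1%R) <= bound%:E)%E.
  move=> /andP[p1 pp0].
  have [C MC] := muckBB p (cst 1) p1 (Ap_cst1 openBB p1).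
  have := operator_norm_le MC; have := operator_norm_ge0 (maximal BB) p (cst 1).
  have := @operator_norm_lt R n (maximal BB) p (cst 1).
  have := @operator_norm_le R n (maximal BB) p (cst 1).
  (* The norm is a finite real r; this finiteness is what allows an inequality bounding r in terms
     of itself to be solved. *)
  case: (operator_norm _ _ _) => [r norm_le norm_lt r0 _|//|//].
  (* Adding 1 puts N strictly above the infimum, hence among the admissible bounds, and makes it at
     least 1. *)
  rewrite lee_fin in r0; pose N := r + 1; pose X := 4 * N + 1.
  have X1 : 1 <= X by rewrite /X /N; lra.
  have boundN : operator_bound (maximal BB) p (cst 1) N.
    by apply: norm_lt; rewrite lte_fin /N ltrDl.
  (* The added 1 makes A positive and strictly larger than the weighted norms. *)
  pose A := a * X `^ t + 1.
  have A0 : 0 < A by rewrite ltr_wpDl// mulr_ge0// powR_ge0.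
  have boundA w : weight w -> (forall x, 0 < w x) ->
      (Ap_constant BB p0 w <= (2 `^ (p0 - 1) * (4 * N + 1) `^ (p0 - p))%:E)%E ->
      operator_bound (maximal BB) p0 w A.
    move=> ww w0 wX; apply: operator_norm_lt.
    have pp : 1 < p < p0 by rewrite p1.
    by rewrite (le_lt_trans (growth p X w pp X1 ww w0 wX))// lte_fin /A ltrDl.
  have N1 : 1 <= N by rewrite /N lerDr.
  have := extrapolation openBB p1 pp0 N1 A0 boundN boundA => /norm_le.
  rewrite !lee_fin => rA.
  have {}rA : r <= A * D.
    apply: (le_trans rA); rewrite ler_wpM2l ?(ltW A0)// /D lerD2r ler_wpM2r//.
    by rewrite ler_powR ?ler1n// ltW.
  apply: (@le_trans _ _ X); first by rewrite /X /N; lra.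
  apply: sublinear_bound => //; rewrite ?mulr_ge0 ?addr_ge0 ?mulr_ge0//.
  have : 4 * r <= 4 * (A * D) by rewrite ler_pM2l.
  by rewrite /A /X /N; move: (_ `^ t) => y; lra.
have : (limf_esup (fun p : R => operator_norm (maximal BB) p (cst 1%R)) 1^'+ <=
    bound%:E)%E.
  (* The upper limit is an infimum of suprema over right neighbourhoods of 1, and the interval from
     1 to p0 is one of them. *)
  apply: ge_ereal_inf; exists (ereal_sup [set operator_norm (maximal BB) p (cst 1%R)
      | p in [set p : R | 1 < p < p0]]).
    exists [set p : R | 1 < p < p0] => //.
    near=> p => /=; apply/andP; split; near: p; first exact: nbhs_right_gt.
    exact: nbhs_right_lt.
  by apply: ge_ereal_sup => _ [p pp <-]; exact: norm_bound.
by rewrite limoo leye_eq.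
Unshelve. all: by end_near.
Qed.
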